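(* Let $G$ be a quasi-semi-simple group acting continuously (i.e. the map $G\times X\to X$ is continuous) and by isometries on a metric space $X$. Suppose there is no point $x\in X$ fixed by a non-compact normal subgroup of $G$. Then every $G$-orbit is closed in $X$ and every point stabilizer is compact in $G$.
   Context: A locally compact group $G$ is quasi-semi-simple (qss) if there is a closed subgroup $A<G$ such that (i) $G=CAC$ for some compact $C\subset G$; (ii) for every net $(a_\alpha)$ in $A$ converging to infinity there is a subnet $(a_\beta)$ such that $U^{(a_\beta)}_+$ is not precompact and the subgroup generated by $U^{(a_\beta)}_+,U^{(a_\beta)}_-,U^{(a_\beta)}_0$ is dense in $G$, where for a net $(g_\alpha)$: $U^{(g_\alpha)}_+=\{x: g_\alpha^{-1}xg_\alpha\to e\}$, $U^{(g_\alpha)}_-=\{x: g_\alpha xg_\alpha^{-1}\to e\}$, and $U^{(g_\alpha)}_0$ is the set of $x$ such that every subnet of each of the nets $(g_\alpha^{-1}xg_\alpha)$, $(g_\alpha xg_\alpha^{-1})$ admits a converging subnet. *)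

(* Defs.v *)
From Stdlib Require Import Reals List Classical.

Definition is_topology {T : Type} (opn : (T -> Prop) -> Prop) : Prop :=
  opn (fun _ => True) /\ opn (fun _ => False) /\
  (forall U V, opn U -> opn V -> opn (fun x => U x /\ V x)) /\
  (forall F : (T -> Prop) -> Prop, (forall U, F U -> opn U) ->
      opn (fun x => exists U, F U /\ U x)).

Definition tcompact {T : Type} (opn : (T -> Prop) -> Prop) (K : T -> Prop) : Prop :=
  forall F : (T -> Prop) -> Prop,
    (forall U, F U -> opn U) ->
    (forall x, K x -> exists U, F U /\ U x) ->
    exists l : list (T -> Prop),
      (forall U, In U l -> F U) /\ (forall x, K x -> exists U, In U l /\ U x).

Definition tclosure {T : Type} (opn : (T -> Prop) -> Prop) (A : T -> Prop) : T -> Prop :=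
  fun x => forall U, opn U -> U x -> exists y, U y /\ A y.

Definition tclosed {T : Type} (opn : (T -> Prop) -> Prop) (A : T -> Prop) : Prop :=
  opn (fun x => ~ A x).

Definition precompact {T : Type} (opn : (T -> Prop) -> Prop) (A : T -> Prop) : Prop :=
  tcompact opn (tclosure opn A).

Definition tdense {T : Type} (opn : (T -> Prop) -> Prop) (A : T -> Prop) : Prop :=
  forall x, tclosure opn A x.

Record DirSet := {
  ds_car :> Type;
  dle : ds_car -> ds_car -> Prop;
  dle_refl : forall i, dle i i;
  dle_trans : forall i j k, dle i j -> dle j k -> dle i k;
  dle_dir : forall i j, exists k, dle i k /\ dle j k;
  ds_inh : inhabited ds_car
}.

Definition conv {T : Type} (opn : (T -> Prop) -> Prop) {D : DirSet}
    (x : D -> T) (y : T) : Prop :=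
  forall U, opn U -> U y -> exists i0 : D, forall i, dle D i0 i -> U (x i).

(* phi : E -> D makes (x (phi j))_{j in E} a subnet of (x i)_{i in D}
   (subnets in the sense of Kelley: phi is eventually above every index). *)
Definition subnet_map (D E : DirSet) (phi : E -> D) : Prop :=
  forall i0 : D, exists j0 : E, forall j, dle E j0 j -> dle D i0 (phi j).

Definition has_conv_subnet {T : Type} (opn : (T -> Prop) -> Prop) {D : DirSet}
    (x : D -> T) : Prop :=
  exists (E : DirSet) (phi : E -> D),
    subnet_map D E phi /\ exists y, conv opn (fun j => x (phi j)) y.

Definition every_subnet_has_conv_subnet {T : Type} (opn : (T -> Prop) -> Prop)
    {D : DirSet} (x : D -> T) : Prop :=
  forall (E : DirSet) (phi : E -> D), subnet_map D E phi ->
    has_conv_subnet opn (fun j => x (phi j)).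

Record TopGroup := {
  tg_car :> Type;
  tg_mul : tg_car -> tg_car -> tg_car;
  tg_inv : tg_car -> tg_car;
  tg_one : tg_car;
  tg_open : (tg_car -> Prop) -> Prop;
  tg_assoc : forall x y z, tg_mul x (tg_mul y z) = tg_mul (tg_mul x y) z;
  tg_mul1g : forall x, tg_mul tg_one x = x;
  tg_mulVg : forall x, tg_mul (tg_inv x) x = tg_one;
  tg_top : is_topology tg_open;
  tg_hausdorff : forall x y, x <> y -> exists U V, tg_open U /\ tg_open V /\
      U x /\ V y /\ (forall z, U z -> V z -> False);
  tg_mul_cont : forall x y W, tg_open W -> W (tg_mul x y) ->
      exists U V, tg_open U /\ tg_open V /\ U x /\ V y /\
        (forall x' y', U x' -> V y' -> W (tg_mul x' y'));
  tg_inv_cont : forall x W, tg_open W -> W (tg_inv x) ->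
      exists U, tg_open U /\ U x /\ (forall x', U x' -> W (tg_inv x'))
}.

Definition locally_compact (G : TopGroup) : Prop :=
  forall x : G, exists (U K : G -> Prop), tg_open G U /\ U x /\
    (forall y, U y -> K y) /\ tcompact (tg_open G) K.

Definition subgroup (G : TopGroup) (H : G -> Prop) : Prop :=
  H (tg_one G) /\ (forall x y, H x -> H y -> H (tg_mul G x y)) /\
  (forall x, H x -> H (tg_inv G x)).

Definition normal_subgroup (G : TopGroup) (N : G -> Prop) : Prop :=
  subgroup G N /\ (forall g n, N n -> N (tg_mul G (tg_mul G g n) (tg_inv G g))).

Definition gen_subgroup (G : TopGroup) (S : G -> Prop) : G -> Prop :=
  fun g => forall H, subgroup G H -> (forall s, S s -> H s) -> H g.

Definition to_infinity (G : TopGroup) {D : DirSet} (a : D -> G) : Prop :=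
  forall K, tcompact (tg_open G) K ->
    exists i0 : D, forall i, dle D i0 i -> ~ K (a i).

Definition Uplus (G : TopGroup) {D : DirSet} (g : D -> G) : G -> Prop :=
  fun x => conv (tg_open G)
             (fun i => tg_mul G (tg_mul G (tg_inv G (g i)) x) (g i)) (tg_one G).

Definition Uminus (G : TopGroup) {D : DirSet} (g : D -> G) : G -> Prop :=
  fun x => conv (tg_open G)
             (fun i => tg_mul G (tg_mul G (g i) x) (tg_inv G (g i))) (tg_one G).

Definition Uzero (G : TopGroup) {D : DirSet} (g : D -> G) : G -> Prop :=
  fun x =>
    every_subnet_has_conv_subnet (tg_open G)
      (fun i => tg_mul G (tg_mul G (tg_inv G (g i)) x) (g i)) /\
    every_subnet_has_conv_subnet (tg_open G)
      (fun i => tg_mul G (tg_mul G (g i) x) (tg_inv G (g i))).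

Definition qss (G : TopGroup) : Prop :=
  locally_compact G /\
  exists A : G -> Prop,
    subgroup G A /\ tclosed (tg_open G) A /\
    (exists C : G -> Prop, tcompact (tg_open G) C /\
       forall g : G, exists c1 a c2, C c1 /\ A a /\ C c2 /\
         g = tg_mul G (tg_mul G c1 a) c2) /\
    (forall (D : DirSet) (a : D -> G), (forall i, A (a i)) -> to_infinity G a ->
       exists (E : DirSet) (phi : E -> D), subnet_map D E phi /\
         ~ precompact (tg_open G) (Uplus G (fun j => a (phi j))) /\
         tdense (tg_open G)
           (gen_subgroup G (fun x => Uplus G (fun j => a (phi j)) x \/
                                     Uminus G (fun j => a (phi j)) x \/
                                     Uzero G (fun j => a (phi j)) x))).

Definition is_metric {X : Type} (d : X -> X -> R) : Prop :=
  (forall x y, (0 <= d x y)%R) /\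
  (forall x y, d x y = 0%R <-> x = y) /\
  (forall x y, d x y = d y x) /\
  (forall x y z, (d x z <= d x y + d y z)%R).

Definition metric_open {X : Type} (d : X -> X -> R) (U : X -> Prop) : Prop :=
  forall y, U y -> exists eps, (0 < eps)%R /\ forall z, (d y z < eps)%R -> U z.

Definition metric_closed {X : Type} (d : X -> X -> R) (A : X -> Prop) : Prop :=
  metric_open d (fun y => ~ A y).

Definition is_action (G : TopGroup) {X : Type} (act : G -> X -> X) : Prop :=
  (forall x, act (tg_one G) x = x) /\
  (forall g h x, act (tg_mul G g h) x = act g (act h x)).

Definition action_continuous (G : TopGroup) {X : Type} (d : X -> X -> R)
    (act : G -> X -> X) : Prop :=
  forall (g : G) (x : X) (eps : R), (0 < eps)%R ->
    exists (U : G -> Prop) (delta : R), tg_open G U /\ U g /\ (0 < delta)%R /\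
      forall g' y, U g' -> (d x y < delta)%R -> (d (act g x) (act g' y) < eps)%R.

Definition isometric_action (G : TopGroup) {X : Type} (d : X -> X -> R)
    (act : G -> X -> X) : Prop :=
  forall (g : G) x y, d (act g x) (act g y) = d x y.

Definition orbit (G : TopGroup) {X : Type} (act : G -> X -> X) (x : X) : X -> Prop :=
  fun y => exists g : G, act g x = y.

Definition stabilizer (G : TopGroup) {X : Type} (act : G -> X -> X) (x : X) : G -> Prop :=
  fun g => act g x = x.

(* Main.v *)
(** If the conclusion fails, some net going to infinity in [G] moves a point [x]
    to points converging in [X]. Writing [G = CAC] and using that [C] is compact,
    there are [z] and [w] with [a z] arbitrarily close to [w] for [a] in [A]
    outside any given compact set. Quotients [a1^-1 a2] of such elements form a
    net [b] in [A] going to infinity with [b z -> z]; thus one may assume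
    [w = z], and then both [U_+] and [U_-] fix [z] (Mautner). As [U_0] normalizes
    [U_+] and [U_-], the group [H] generated by [U_+] and [U_-] is normalized by
    a dense subgroup, so [H] lies in the normal core of the stabilizer of [z].
    This core is closed, normal, not compact, and fixes [z]. *)

Require Import Defs.
From Stdlib Require Import Reals List Classical.
From Stdlib Require Import Lra FunctionalExtensionality PropExtensionality.

(** * Group identities and conjugation *)

Lemma tg_mulKg (G : TopGroup) (x y : G) : tg_mul G (tg_inv G x) (tg_mul G x y) = y.
Proof. now rewrite tg_assoc, tg_mulVg, tg_mul1g. Qed.

Lemma tg_mulgV (G : TopGroup) (x : G) : tg_mul G x (tg_inv G x) = tg_one G.
Proof.
  rewrite <- (tg_mulKg G (tg_inv G x) (tg_mul G x (tg_inv G x))).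
  now rewrite (tg_mulKg G x), tg_mulVg.
Qed.

Lemma tg_mulg1 (G : TopGroup) (x : G) : tg_mul G x (tg_one G) = x.
Proof. now rewrite <- (tg_mulVg G x), tg_assoc, tg_mulgV, tg_mul1g. Qed.

Lemma tg_mulVKg (G : TopGroup) (x y : G) : tg_mul G x (tg_mul G (tg_inv G x) y) = y.
Proof. now rewrite tg_assoc, tg_mulgV, tg_mul1g. Qed.

Lemma tg_inv_uniq (G : TopGroup) (x y : G) : tg_mul G x y = tg_one G -> y = tg_inv G x.
Proof. intros E. now rewrite <- (tg_mulKg G x y), E, tg_mulg1. Qed.

Lemma tg_invK (G : TopGroup) (x : G) : tg_inv G (tg_inv G x) = x.
Proof. symmetry. apply tg_inv_uniq, tg_mulVg. Qed.

Lemma tg_invM (G : TopGroup) (x y : G) :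
  tg_inv G (tg_mul G x y) = tg_mul G (tg_inv G y) (tg_inv G x).
Proof.
  symmetry. apply tg_inv_uniq.
  now rewrite <- tg_assoc, tg_mulVKg, tg_mulgV.
Qed.

Definition conjg {G : TopGroup} (g x : G) : G :=
  tg_mul G (tg_mul G g x) (tg_inv G g).

Lemma conjg_comp (G : TopGroup) (g h x : G) :
  conjg (tg_mul G g h) x = conjg g (conjg h x).
Proof. unfold conjg. now rewrite tg_invM, !tg_assoc. Qed.

Lemma conj1g (G : TopGroup) (x : G) : conjg (tg_one G) x = x.
Proof.
  unfold conjg. rewrite tg_mul1g, <- (tg_inv_uniq G (tg_one G) (tg_one G)).
  - apply tg_mulg1.
  - apply tg_mul1g.
Qed.

Lemma conjg1 (G : TopGroup) (g : G) : conjg g (tg_one G) = tg_one G.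
Proof. unfold conjg. now rewrite tg_mulg1, tg_mulgV. Qed.

Lemma conjgM (G : TopGroup) (g x y : G) :
  conjg g (tg_mul G x y) = tg_mul G (conjg g x) (conjg g y).
Proof. unfold conjg. now rewrite <- !tg_assoc, tg_mulKg. Qed.

Lemma conjgV (G : TopGroup) (g x : G) : conjg g (tg_inv G x) = tg_inv G (conjg g x).
Proof. apply tg_inv_uniq. now rewrite <- conjgM, tg_mulgV, conjg1. Qed.

Lemma conjg_conj (G : TopGroup) (g x u : G) :
  conjg g (conjg x u) = conjg (conjg g x) (conjg g u).
Proof. unfold conjg at 2. now rewrite !conjgM, conjgV. Qed.

Lemma conjg_cont (G : TopGroup) (g x : G) (W : G -> Prop) :
  tg_open G W -> W (conjg g x) ->
  exists U V, tg_open G U /\ tg_open G V /\ U g /\ V x /\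
    forall g' x', U g' -> V x' -> W (conjg g' x').
Proof.
  intros Wo Wgx.
  destruct (tg_mul_cont G _ _ W Wo Wgx) as (P & Q & Po & Qo & Px & Qx & PQ).
  destruct (tg_mul_cont G _ _ P Po Px) as (U & V & Uo & Vo & Ux & Vx & UV).
  destruct (tg_inv_cont G _ Q Qo Qx) as (U' & Uo' & Ux' & HU').
  exists (fun z => U z /\ U' z), V.
  destruct (tg_top G) as (_ & _ & topI & _).
  repeat split; auto.
  intros g' x' [? ?] ?. apply PQ; auto.
Qed.

(** * Compact sets and finite covers *)

Lemma open_local {T : Type} (opn : (T -> Prop) -> Prop) (P : T -> Prop) :
  is_topology opn ->
  (forall x, P x -> exists U, opn U /\ U x /\ forall y, U y -> P y) -> opn P.
Proof.
  intros (_ & _ & _ & topU) HP.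
  (* [P] is the union of the open sets inside it; this must be an equality of predicates, since
     [opn] is not assumed to respect pointwise equivalence. *)
  replace P with (fun x => exists U, (opn U /\ forall y, U y -> P y) /\ U x).
  - apply topU. tauto.
  - apply functional_extensionality; intros x.
    apply propositional_extensionality; split.
    + intros (U & [_ HU] & Ux). auto.
    + intros Px. destruct (HP x Px) as (U & Uo & Ux & HU). eauto.
Qed.

(** Induction over a compact set: the open sets satisfying [P] cover [K], and [P] passes to the
    union of a finite subcover, hence to [K]. It replaces explicit choices of subcovers in the
    uniformity arguments below. *)
Lemma compact_ind {T : Type} (opn : (T -> Prop) -> Prop) (K : T -> Prop)
    (P : (T -> Prop) -> Prop) :
  tcompact opn K ->
  P (fun _ => False) ->
  (forall U V, P U -> P V -> P (fun x => U x \/ V x)) ->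
  (forall U V : T -> Prop, (forall x, U x -> V x) -> P V -> P U) ->
  (forall x, K x -> exists U, opn U /\ U x /\ P U) ->
  P K.
Proof.
  intros HK P0 PU Psub Ploc.
  destruct (HK (fun U => opn U /\ P U)) as (l & lP & lK).
  - tauto.
  - intros x Kx. destruct (Ploc x Kx) as (U & ? & ? & ?). exists U. auto.
  - apply (Psub _ (fun x => exists U, In U l /\ U x)); [exact lK|].
    clear lK. induction l as [|V l IH].
    (* The union over the empty list has no points. *)
    + apply (Psub _ _ (fun x '(ex_intro _ U (conj F _)) => F) P0).
    + apply (Psub _ (fun x => V x \/ exists U, In U l /\ U x)).
      * intros x (U & [<-|Ul] & Ux); eauto.
      * apply PU; [apply lP; now left|].
        apply IH. intros U Ul. apply lP. now right.
Qed.

(** The conclusion of [tcompact], isolated so that it can serve as the predicate in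
    [compact_ind]. *)
Definition finitely_covered {T : Type} (F : (T -> Prop) -> Prop) (S : T -> Prop) : Prop :=
  exists l : list (T -> Prop),
    (forall U, In U l -> F U) /\ (forall x, S x -> exists U, In U l /\ U x).

Lemma finitely_covered0 {T : Type} (F : (T -> Prop) -> Prop) (S : T -> Prop) :
  (forall x, ~ S x) -> finitely_covered F S.
Proof.
  intros S0. exists nil. split; [intros U []|].
  intros x Sx. destruct (S0 x Sx).
Qed.

Lemma finitely_covered1 {T : Type} (F : (T -> Prop) -> Prop) (S U : T -> Prop) :
  F U -> (forall x, S x -> U x) -> finitely_covered F S.
Proof.
  intros FU SU. exists (U :: nil). split.
  - intros V [<-|[]]. exact FU.
  - intros x Sx. exists U. split; [now left|auto].
Qed.

Lemma finitely_coveredU {T : Type} (F : (T -> Prop) -> Prop) (S1 S2 S : T -> Prop) :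
  (forall x, S x -> S1 x \/ S2 x) ->
  finitely_covered F S1 -> finitely_covered F S2 -> finitely_covered F S.
Proof.
  intros HS (l1 & F1 & C1) (l2 & F2 & C2). exists (l1 ++ l2). split.
  - intros U HU. apply in_app_or in HU. destruct HU; auto.
  - intros x Sx. destruct (HS x Sx) as [H|H];
      [destruct (C1 x H) as (U & ? & ?)|destruct (C2 x H) as (U & ? & ?)];
      exists U; split; auto; apply in_or_app; auto.
Qed.

Lemma finitely_covered_sub {T : Type} (F : (T -> Prop) -> Prop) (S S' : T -> Prop) :
  (forall x, S x -> S' x) -> finitely_covered F S' -> finitely_covered F S.
Proof. intros HS (l & ? & ?). exists l. auto. Qed.

(** Compact induction on [K], each piece being cut down to [A]: near a point of [A] one member of
    the cover suffices, near any other point nothing is left to cover. The pointwise form of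
    closedness applies to closures without assuming [is_topology]. *)
Lemma compact_closed_sub {T : Type} (opn : (T -> Prop) -> Prop) (K A : T -> Prop) :
  tcompact opn K -> (forall x, A x -> K x) ->
  (forall x, ~ A x -> exists U, opn U /\ U x /\ forall y, U y -> ~ A y) ->
  tcompact opn A.
Proof.
  intros HK AK Acl F Fo FA.
  apply (finitely_covered_sub F _ (fun x => K x /\ A x)); [auto|].
  apply (compact_ind opn K (fun S => finitely_covered F (fun x => S x /\ A x)) HK).
  - apply finitely_covered0. tauto.
  - intros U V. apply finitely_coveredU. tauto.
  - intros U V UV. apply finitely_covered_sub. intros x []. auto.
  - intros x Kx. destruct (classic (A x)) as [Ax|nAx].
    + destruct (FA x Ax) as (U & FU & Ux). exists U. repeat split; auto.
      apply (finitely_covered1 F _ U FU). tauto.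
    + destruct (Acl x nAx) as (U & Uo & Ux & UA). exists U. repeat split; auto.
      apply finitely_covered0. intros y [Uy Ay]. exact (UA y Uy Ay).
Qed.

Lemma compact_union {T : Type} (opn : (T -> Prop) -> Prop) (K L : T -> Prop) :
  tcompact opn K -> tcompact opn L -> tcompact opn (fun x => K x \/ L x).
Proof.
  intros HK HL F Fo FKL.
  apply (finitely_coveredU F K L); [auto|apply HK|apply HL]; auto.
Qed.

Lemma compact_empty {T : Type} (opn : (T -> Prop) -> Prop) :
  tcompact opn (fun _ => False).
Proof. intros F _ _. apply finitely_covered0. auto. Qed.

Lemma compact_singleton {T : Type} (opn : (T -> Prop) -> Prop) (a : T) :
  tcompact opn (fun x => x = a).
Proof.
  intros F _ Fa. destruct (Fa a eq_refl) as (U & FU & Ua).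
  apply (finitely_covered1 F _ U FU). now intros x ->.
Qed.

Lemma precompact_sub {T : Type} (opn : (T -> Prop) -> Prop) (K A : T -> Prop) :
  tclosed opn K -> tcompact opn K -> (forall x, A x -> K x) -> precompact opn A.
Proof.
  intros Kcl HK AK. apply (compact_closed_sub opn K); [exact HK| |].
  - intros x Ax. apply NNPP. intros nKx.
    destruct (Ax _ Kcl nKx) as (y & nKy & Ay). auto.
  - intros x nAx. apply NNPP. intros H. apply nAx. intros U Uo Ux.
    apply NNPP. intros H'. apply H. exists U. repeat split; auto.
Qed.

(** The tube lemma argument, as two nested compact inductions: for fixed [k], the inner one runs
    over [L] and shrinks a neighbourhood of [k] finitely often. *)
Lemma compact_mul (G : TopGroup) (K L : G -> Prop) :
  tcompact (tg_open G) K -> tcompact (tg_open G) L ->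
  tcompact (tg_open G) (fun g => exists k l, K k /\ L l /\ g = tg_mul G k l).
Proof.
  intros HK HL F Fo FKL.
  set (prod := fun (S S' : G -> Prop) g => exists k l, S k /\ S' l /\ g = tg_mul G k l).
  destruct (tg_top G) as (topT & _ & topI & _).
  apply (compact_ind (tg_open G) K (fun S => finitely_covered F (prod S L)) HK).
  - apply finitely_covered0. intros g (k & l & [] & _).
  - intros U V. apply finitely_coveredU.
    intros g (k & l & [Uk|Vk] & Ll & Eg); [left|right]; exists k, l; auto.
  - intros U V UV. apply finitely_covered_sub.
    intros g (k & l & Uk & Ll & Eg). exists k, l. auto.
  - intros k Kk.
    apply (compact_ind (tg_open G) L (fun S => exists U, tg_open G U /\ U k /\
             finitely_covered F (prod U S)) HL).
    + exists (fun _ => True). repeat split; auto.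
      apply finitely_covered0. intros g (? & l & _ & [] & _).
    + intros S S' (U & Uo & Uk & HU) (V & Vo & Vk & HV).
      exists (fun g => U g /\ V g). repeat split; auto.
      apply (finitely_coveredU F (prod U S) (prod V S')); auto.
      intros g (k' & l & [Uk' Vk'] & [Sl|Sl] & Eg); [left|right]; exists k', l; auto.
    + intros S S' SS (U & Uo & Uk & HU). exists U. repeat split; auto.
      revert HU. apply finitely_covered_sub.
      intros g (k' & l & ? & ? & Eg). exists k', l. auto.
    + intros l Ll.
      destruct (FKL (tg_mul G k l)) as (W & FW & Wkl); [exists k, l; auto|].
      destruct (tg_mul_cont G k l W (Fo W FW) Wkl) as (U & V & Uo & Vo & Uk & Vl & UV).
      exists V. repeat split; auto. exists U. repeat split; auto.
      apply (finitely_covered1 F _ W FW).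
      intros g (k' & l' & Uk' & Vl' & ->). auto.
Qed.

(** * Nets and the contraction sets of a net *)

Lemma conv_subnet {T : Type} (opn : (T -> Prop) -> Prop) (D E : DirSet) (x : D -> T)
    (y : T) (phi : E -> D) :
  subnet_map D E phi -> conv opn x y -> conv opn (fun j => x (phi j)) y.
Proof.
  intros Hphi Hx U Uo Uy. destruct (Hx U Uo Uy) as (i0 & Hi0).
  destruct (Hphi i0) as (j0 & Hj0). exists j0. auto.
Qed.

Lemma cofinal_subset_dir (D : DirSet) (P : D -> Prop) :
  (forall i, exists j, dle D i j /\ P j) ->
  forall i j : {i : D | P i}, exists k : {i : D | P i},
    dle D (proj1_sig i) (proj1_sig k) /\ dle D (proj1_sig j) (proj1_sig k).
Proof.
  intros HP [i Pi] [j Pj]. destruct (dle_dir D i j) as (k & ik & jk).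
  destruct (HP k) as (m & km & Pm). exists (exist _ m Pm). simpl.
  split; eapply dle_trans; eauto.
Qed.

Lemma cofinal_subset_inh (D : DirSet) (P : D -> Prop) :
  (forall i, exists j, dle D i j /\ P j) -> inhabited {i : D | P i}.
Proof.
  intros HP. destruct (ds_inh D) as [i]. destruct (HP i) as (j & _ & Pj).
  exact (inhabits (exist _ j Pj)).
Qed.

(** Turns the failure of convergence into a subnet along which it fails at every index. *)
Definition cofinal_subset (D : DirSet) (P : D -> Prop)
    (HP : forall i, exists j, dle D i j /\ P j) : DirSet :=
  {| ds_car := {i : D | P i};
     dle := fun i j => dle D (proj1_sig i) (proj1_sig j);
     dle_refl := fun i => dle_refl D (proj1_sig i);
     dle_trans := fun i j k => dle_trans D (proj1_sig i) (proj1_sig j) (proj1_sig k);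
     dle_dir := cofinal_subset_dir D P HP;
     ds_inh := cofinal_subset_inh D P HP |}.

Lemma cofinal_subset_subnet (D : DirSet) (P : D -> Prop)
    (HP : forall i, exists j, dle D i j /\ P j) :
  subnet_map D (cofinal_subset D P HP) (@proj1_sig _ _).
Proof.
  intros i. destruct (HP i) as (j & ij & Pj).
  exists (exist _ j Pj). intros k jk. exact (dle_trans D _ _ _ ij jk).
Qed.

(** Otherwise the conjugates of [conjg x u] stay outside some neighbourhood [W] of the identity
    along a subnet. On a further subnet [conjg (b i) x] converges to some [y], so those conjugates
    converge to [conjg y 1 = 1], a contradiction. *)
Lemma Uminus_conj (G : TopGroup) (E : DirSet) (b : E -> G) (x u : G) :
  every_subnet_has_conv_subnet (tg_open G) (fun i => conjg (b i) x) ->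
  Uminus G b u -> Uminus G b (conjg x u).
Proof.
  intros Hx Hu W Wo W1. apply NNPP. intros HW.
  assert (HP : forall i, exists j, dle E i j /\ ~ W (conjg (b j) (conjg x u))).
  { intros i. apply NNPP. intros H. apply HW. exists i. intros j ij.
    apply NNPP. intros nW. apply H. exists j. auto. }
  destruct (Hx _ _ (cofinal_subset_subnet E _ HP)) as (F & psi & Hpsi & y & Hy).
  pose proof (conv_subnet _ _ _ _ _ psi Hpsi
    (conv_subnet _ _ _ _ _ _ (cofinal_subset_subnet E _ HP) Hu)) as Hu'.
  (* Presents the identity as a value of conjugation, so that joint continuity applies at the pair
     of [y] and the identity. *)
  rewrite <- (conjg1 G y) in W1.
  destruct (conjg_cont G _ _ W Wo W1) as (U & V & Uo & Vo & Uy & V1 & UV).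
  destruct (Hy U Uo Uy) as (j1 & Hj1). destruct (Hu' V Vo V1) as (j2 & Hj2).
  destruct (dle_dir F j1 j2) as (j & H1 & H2).
  apply (proj2_sig (psi j)). rewrite conjg_conj. apply UV.
  - exact (Hj1 j H1).
  - exact (Hj2 j H2).
Qed.

Lemma every_subnet_conv_conjV (G : TopGroup) (E : DirSet) (b : E -> G) (x : G) :
  every_subnet_has_conv_subnet (tg_open G) (fun i => conjg (b i) x) ->
  every_subnet_has_conv_subnet (tg_open G) (fun i => conjg (b i) (tg_inv G x)).
Proof.
  intros Hx D phi Hphi. destruct (Hx D phi Hphi) as (F & psi & Hpsi & y & Hy).
  exists F, psi. split; [exact Hpsi|]. exists (tg_inv G y). intros W Wo Wy.
  destruct (tg_inv_cont G y W Wo Wy) as (U & Uo & Uy & HU).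
  destruct (Hy U Uo Uy) as (j0 & Hj0). exists j0. intros j jj.
  rewrite conjgV. auto.
Qed.

Lemma conj_netV (G : TopGroup) (E : DirSet) (b : E -> G) (x : G) :
  (fun i => tg_mul G (tg_mul G (tg_inv G (b i)) x) (b i)) =
  (fun i => conjg (tg_inv G (b i)) x).
Proof.
  apply functional_extensionality. intros i. unfold conjg. now rewrite tg_invK.
Qed.

(** Inverting the net exchanges the two contraction groups, so only [Uminus] has to be treated
    directly. *)
Lemma Uplus_Uminus (G : TopGroup) (E : DirSet) (b : E -> G) (x : G) :
  Uplus G b x <-> Uminus G (fun i => tg_inv G (b i)) x.
Proof. unfold Uplus. now rewrite conj_netV. Qed.

Lemma Uzero_inv (G : TopGroup) (E : DirSet) (b : E -> G) (x : G) :
  Uzero G b x -> Uzero G b (tg_inv G x).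
Proof.
  unfold Uzero. rewrite !conj_netV. intros [H1 H2].
  split; now apply every_subnet_conv_conjV.
Qed.

Lemma Uzero_norm_Uplus (G : TopGroup) (E : DirSet) (b : E -> G) (x u : G) :
  Uzero G b x -> Uplus G b u -> Uplus G b (conjg x u).
Proof.
  rewrite !Uplus_Uminus. intros [H _]. rewrite conj_netV in H.
  now apply Uminus_conj.
Qed.

Lemma Uzero_norm_Uminus (G : TopGroup) (E : DirSet) (b : E -> G) (x u : G) :
  Uzero G b x -> Uminus G b u -> Uminus G b (conjg x u).
Proof. intros [_ H]. now apply Uminus_conj. Qed.

(** * Generated subgroups and their normalizers *)

Lemma gen_subgroup_subgroup (G : TopGroup) (S : G -> Prop) : subgroup G (gen_subgroup G S).
Proof.
  split; [|split].
  - intros H [H1 _] _. exact H1.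
  - intros x y Hx Hy H sH SH. apply sH; [now apply Hx|now apply Hy].
  - intros x Hx H sH SH. apply sH. now apply Hx.
Qed.

(** The elements whose conjugate by [g] stays in the generated subgroup form a subgroup containing
    [S]. *)
Lemma gen_subgroup_conj (G : TopGroup) (S : G -> Prop) (g h : G) :
  (forall s, S s -> gen_subgroup G S (conjg g s)) ->
  gen_subgroup G S h -> gen_subgroup G S (conjg g h).
Proof.
  intros HS Hh. apply (Hh (fun h => gen_subgroup G S (conjg g h))); [|exact HS].
  destruct (gen_subgroup_subgroup G S) as (H1 & HM & HV). split; [|split].
  - now rewrite conjg1.
  - intros x y. rewrite conjgM. apply HM.
  - intros x. rewrite conjgV. apply HV.
Qed.

Lemma gen_Upm_normalized (G : TopGroup) (E : DirSet) (b : E -> G) (g h : G) :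
  gen_subgroup G (fun x => Uplus G b x \/ Uminus G b x \/ Uzero G b x) g ->
  gen_subgroup G (fun x => Uplus G b x \/ Uminus G b x) h ->
  gen_subgroup G (fun x => Uplus G b x \/ Uminus G b x) (conjg g h).
Proof.
  set (H := gen_subgroup G (fun x => Uplus G b x \/ Uminus G b x)). intros Hg Hh.
  destruct (gen_subgroup_subgroup G (fun x => Uplus G b x \/ Uminus G b x))
    as (H1 & HM & HV). fold H in H1, HM, HV.
  assert (Hself : forall x y, H x -> H y -> H (conjg x y)) by (unfold conjg; auto).
  assert (HU0 : forall x y, Uzero G b x -> H y -> H (conjg x y)).
  { intros x y Ux. apply gen_subgroup_conj. intros s [Us|Us] L sL SL; apply SL.
    - left. now apply Uzero_norm_Uplus.
    - right. now apply Uzero_norm_Uminus. }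
  (* Conjugating [H] into itself is not stable under inverses in general, so the condition is
     imposed on [g] and its inverse together; it then defines a subgroup. *)
  apply (Hg (fun g => forall h, H h -> H (conjg g h) /\ H (conjg (tg_inv G g) h)));
    [|clear h Hh|exact Hh].
  - split; [|split].
    + intros k Hk. rewrite <- (tg_inv_uniq G _ _ (tg_mul1g G (tg_one G))), conj1g. auto.
    + intros x y Hx Hy k Hk. rewrite tg_invM, !conjg_comp.
      split; [apply Hx, Hy, Hk|apply Hy, Hx, Hk].
    + intros x Hx k Hk. rewrite tg_invK. destruct (Hx k Hk). auto.
  - intros s Hs k Hk. destruct Hs as [Us|[Us|Us]].
    + assert (H s) by (intros L _ SL; auto). auto.
    + assert (H s) by (intros L _ SL; auto). auto.
    + split; apply HU0; auto. now apply Uzero_inv.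
Qed.

(** * Isometric actions and the Mautner phenomenon *)

Lemma metric_eq {X : Type} (d : X -> X -> R) (x y : X) :
  is_metric d -> (forall eps, (0 < eps)%R -> (d x y < eps)%R) -> x = y.
Proof.
  intros (d0 & deq & _) H. apply deq. destruct (d0 x y) as [Hp|]; [|auto].
  specialize (H _ Hp). lra.
Qed.

(** With [c = conjg (b i) u], isometry gives [d (u z) z = d (c (b i z)) (b i z)]. Here [c] is close
    to the identity and [b i z] is close to [z], so the right side is arbitrarily small. *)
Lemma contracted_fixes (G : TopGroup) (X : Type) (d : X -> X -> R) (act : G -> X -> X)
    (E : DirSet) (b : E -> G) (z : X) (u : G) :
  is_metric d -> is_action G act -> action_continuous G d act -> isometric_action G d act ->
  (forall eps, (0 < eps)%R -> exists i0, forall i, dle E i0 i -> (d (act (b i) z) z < eps)%R) ->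
  Uminus G b u -> act u z = z.
Proof.
  intros Hd [act1 actM] Hcont Hiso Hz Hu. apply (metric_eq d _ _ Hd). intros eps He.
  (* One third for each leg of the path from [c (b i z)] through [c z] and [z] to [b i z]. *)
  destruct (Hcont (tg_one G) z (eps / 3)%R) as (U & delta & Uo & U1 & Hdel & HU); [lra|].
  destruct (Hu U Uo U1) as (i1 & Hi1).
  destruct (Hz (eps / 3)%R) as (i2 & Hi2); [lra|].
  destruct (dle_dir E i1 i2) as (i & H1 & H2).
  specialize (Hi2 i H2). specialize (Hi1 i H1). fold (conjg (b i) u) in Hi1.
  destruct Hd as (d0 & deq & dsym & dtri).
  assert (dzz : d z z = 0%R) by now apply deq.
  specialize (HU _ z Hi1). rewrite act1, dzz in HU. specialize (HU Hdel).
  assert (E1 : act (b i) (act u z) = act (conjg (b i) u) (act (b i) z)).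
  { rewrite <- !actM. unfold conjg. now rewrite <- !tg_assoc, tg_mulVg, tg_mulg1. }
  rewrite <- (Hiso (b i)), E1.
  pose proof (Hiso (conjg (b i) u) (act (b i) z) z).
  pose proof (dtri (act (conjg (b i) u) (act (b i) z)) (act (conjg (b i) u) z) (act (b i) z)).
  pose proof (dtri (act (conjg (b i) u) z) z (act (b i) z)).
  rewrite (dsym (act (conjg (b i) u) z) z) in *.
  rewrite (dsym z (act (b i) z)) in *. lra.
Qed.

Lemma act_near (G : TopGroup) (X : Type) (d : X -> X -> R) (act : G -> X -> X)
    (g : G) (x : X) (eps : R) :
  is_metric d -> action_continuous G d act -> (0 < eps)%R ->
  exists U, tg_open G U /\ U g /\ forall g', U g' -> (d (act g x) (act g' x) < eps)%R.
Proof.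
  intros (_ & deq & _) Hcont He.
  destruct (Hcont g x eps He) as (U & delta & Uo & Ug & Hdel & HU).
  exists U. repeat split; auto. intros g' Ug'. apply HU; auto.
  now rewrite (proj2 (deq x x) eq_refl).
Qed.

Lemma not_stabilizer_open (G : TopGroup) (X : Type) (d : X -> X -> R) (act : G -> X -> X)
    (x : X) :
  is_metric d -> action_continuous G d act ->
  tg_open G (fun g => ~ stabilizer G act x g).
Proof.
  intros Hd Hcont. apply open_local; [apply tg_top|]. intros g Hg.
  assert (Hpos : (0 < d (act g x) x)%R).
  { destruct Hd as (d0 & deq & _). destruct (d0 (act g x) x) as [|E]; auto.
    destruct Hg. now apply deq. }
  (* The radius is the displacement of [x] by [g] itself: a nearby element fixing [x] would make
     this displacement less than itself. *)
  destruct (act_near G X d act g x _ Hd Hcont Hpos) as (U & Uo & Ug & HU).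
  exists U. repeat split; auto. intros g' Ug' E. specialize (HU g' Ug').
  rewrite E in HU. lra.
Qed.

Lemma stabilizer_subgroup (G : TopGroup) (X : Type) (act : G -> X -> X) (x : X) :
  is_action G act -> subgroup G (stabilizer G act x).
Proof.
  intros [act1 actM]. unfold stabilizer. split; [|split].
  - apply act1.
  - intros g h Hg Hh. now rewrite actM, Hh.
  - intros g Hg. rewrite <- Hg at 1. now rewrite <- actM, tg_mulVg.
Qed.

(** * Normal cores of stabilizers *)

Definition normal_core (G : TopGroup) (S : G -> Prop) : G -> Prop :=
  fun n => forall g, S (conjg g n).

Lemma normal_core_normal (G : TopGroup) (S : G -> Prop) :
  subgroup G S -> normal_subgroup G (normal_core G S).
Proof.
  intros (S1 & SM & SV). split; [split; [|split]|].
  - intros g. now rewrite conjg1.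
  - intros x y Hx Hy g. rewrite conjgM. auto.
  - intros x Hx g. rewrite conjgV. auto.
  - intros h n Hn g. fold (conjg h n). rewrite <- conjg_comp. auto.
Qed.

Lemma normal_core_closed (G : TopGroup) (S : G -> Prop) :
  tclosed (tg_open G) S -> tclosed (tg_open G) (normal_core G S).
Proof.
  intros Scl. apply (open_local (tg_open G)); [apply tg_top|]. intros n Hn.
  apply not_all_ex_not in Hn. destruct Hn as (g & Hg).
  destruct (conjg_cont G g n _ Scl Hg) as (U & V & Uo & Vo & Ug & Vn & UV).
  exists V. repeat split; auto. intros n' Vn' H. exact (UV g n' Ug Vn' (H g)).
Qed.

(** For fixed [h], the condition that [conjg g h] lies in [S] is closed in [g], so it extends from a
    dense set to all of [G]. *)
Lemma normal_core_dense (G : TopGroup) (S L : G -> Prop) (h : G) :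
  tclosed (tg_open G) S -> tdense (tg_open G) L ->
  (forall g, L g -> S (conjg g h)) -> normal_core G S h.
Proof.
  intros Scl Ld HL g. apply NNPP. intros Hg.
  destruct (conjg_cont G g h _ Scl Hg) as (U & V & Uo & Vo & Ug & Vh & UV).
  destruct (Ld g U Uo Ug) as (g' & Ug' & Lg'). exact (UV g' h Ug' Vh (HL g' Lg')).
Qed.

(** A dense set of [g] conjugates [u] into the group generated by [Uplus] and [Uminus], whose
    generators fix [z] by contraction. *)
Lemma core_contains_Uplus (G : TopGroup) (X : Type) (d : X -> X -> R) (act : G -> X -> X)
    (E : DirSet) (b : E -> G) (z : X) :
  is_metric d -> is_action G act -> action_continuous G d act -> isometric_action G d act ->
  (forall eps, (0 < eps)%R -> exists i0, forall i, dle E i0 i -> (d (act (b i) z) z < eps)%R) ->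
  tdense (tg_open G)
    (gen_subgroup G (fun x => Uplus G b x \/ Uminus G b x \/ Uzero G b x)) ->
  forall u, Uplus G b u -> normal_core G (stabilizer G act z) u.
Proof.
  intros Hd Hact Hcont Hiso Hz Hdense u Hu.
  apply (normal_core_dense G _ _ u (not_stabilizer_open G X d act z Hd Hcont) Hdense).
  intros g Hg.
  assert (Hgu : gen_subgroup G (fun x => Uplus G b x \/ Uminus G b x) (conjg g u)).
  { apply gen_Upm_normalized; [exact Hg|]. intros L _ SL. auto. }
  apply Hgu; [now apply stabilizer_subgroup|]. intros s [Hs|Hs].
  (* The inverse net also brings [z] back to itself, because an isometry and its inverse displace
     [z] equally. *)
  - rewrite Uplus_Uminus in Hs.
    apply (contracted_fixes G X d act E (fun i => tg_inv G (b i)) z s); auto.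
    intros eps He. destruct (Hz eps He) as (i0 & Hi0). exists i0. intros i ii.
    destruct Hact as [act1 actM]. destruct Hd as (_ & _ & dsym & _).
    rewrite <- (Hiso (b i)), <- actM, tg_mulgV, act1, dsym. auto.
  - now apply (contracted_fixes G X d act E b z s).
Qed.

(** * Recurrence *)

(* [recurs G d act B x y]: there is a net in [B] going to infinity in [G] along which
   the translates of [x] converge to [y]. *)
Definition recurs (G : TopGroup) {X : Type} (d : X -> X -> R) (act : G -> X -> X)
    (B : G -> Prop) (x y : X) : Prop :=
  forall (eps : R) (K : G -> Prop), (0 < eps)%R -> tcompact (tg_open G) K ->
    exists g, B g /\ ~ K g /\ (d (act g x) y < eps)%R.

(** Each index carries its own witness [ri_elt], so the net is a projection and no choice of
    witnesses is made. *)
Record recur_index (G : TopGroup) {X : Type} (d : X -> X -> R) (act : G -> X -> X)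
    (B : G -> Prop) (x y : X) := RecurIndex {
  ri_eps : R;
  ri_set : G -> Prop;
  ri_elt : G;
  ri_pos : (0 < ri_eps)%R;
  ri_compact : tcompact (tg_open G) ri_set;
  ri_in : B ri_elt;
  ri_notin : ~ ri_set ri_elt;
  ri_near : (d (act ri_elt x) y < ri_eps)%R
}.

Lemma recurs_net (G : TopGroup) (X : Type) (d : X -> X -> R) (act : G -> X -> X)
    (B : G -> Prop) (x y : X) :
  recurs G d act B x y ->
  exists (D : DirSet) (b : D -> G), (forall i, B (b i)) /\ to_infinity G b /\
    forall eps, (0 < eps)%R -> exists i0, forall i, dle D i0 i -> (d (act (b i) x) y < eps)%R.
Proof.
  intros HB.
  set (I := recur_index G d act B x y).
  (* The order compares only the precision and the compact set. It is a mere preorder, which is all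
     that [DirSet] asks. *)
  set (le := fun i j : I => (ri_eps _ _ _ _ _ _ j <= ri_eps _ _ _ _ _ _ i)%R /\
    forall g, ri_set _ _ _ _ _ _ i g -> ri_set _ _ _ _ _ _ j g).
  assert (Hex : forall eps K, (0 < eps)%R -> tcompact (tg_open G) K ->
    exists i : I, ri_eps _ _ _ _ _ _ i = eps /\ ri_set _ _ _ _ _ _ i = K).
  { intros eps K He HK. destruct (HB eps K He HK) as (g & Bg & Kg & Hg).
    now exists (RecurIndex G X d act B x y eps K g He HK Bg Kg Hg). }
  assert (le_refl : forall i, le i i) by (intros i; split; auto with real).
  assert (le_trans : forall i j k, le i j -> le j k -> le i k).
  { intros i j k [] []. split; [lra|auto]. }
  assert (le_dir : forall i j, exists k, le i k /\ le j k).
  { intros i j.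
    destruct (Hex (Rmin (ri_eps _ _ _ _ _ _ i) (ri_eps _ _ _ _ _ _ j))
      (fun g => ri_set _ _ _ _ _ _ i g \/ ri_set _ _ _ _ _ _ j g)) as (k & E1 & E2).
    - apply Rmin_pos; apply ri_pos.
    - apply compact_union; apply ri_compact.
    - exists k. unfold le. rewrite E1, E2.
      split; (split; [apply Rmin_l || apply Rmin_r|auto]). }
  assert (inh : inhabited I).
  { destruct (Hex 1%R (fun _ => False) Rlt_0_1 (compact_empty _)) as (i & _).
    exact (inhabits i). }
  exists (Build_DirSet I le le_refl le_trans le_dir inh), (ri_elt _ _ _ _ _ _).
  split; [|split].
  - intros i. apply ri_in.
  - intros K HK. destruct (Hex 1%R K Rlt_0_1 HK) as (i0 & _ & E).
    exists i0. intros i [_ Hi] Ki. rewrite E in Hi.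
    exact (ri_notin _ _ _ _ _ _ i (Hi _ Ki)).
  - intros eps He. destruct (Hex eps _ He (compact_empty _)) as (i0 & E & _).
    exists i0. intros i [Hi _]. rewrite E in Hi.
    pose proof (ri_near _ _ _ _ _ _ i). simpl in *. lra.
Qed.

Lemma recurs_self (G : TopGroup) (X : Type) (d : X -> X -> R) (act : G -> X -> X)
    (A : G -> Prop) (z w : X) :
  is_metric d -> is_action G act -> isometric_action G d act -> subgroup G A ->
  recurs G d act A z w -> recurs G d act A z z.
Proof.
  intros (d0 & deq & dsym & dtri) [act1 actM] Hiso (_ & AM & AV) Hzw eps K He HK.
  (* First [a1] is fixed with [a1 z] near [w]; then [a2] is chosen outside [a1 K], which puts the
     quotient [a1^-1 a2] outside [K]. *)
  destruct (Hzw (eps / 2)%R _ ltac:(lra) (compact_empty _)) as (a1 & A1 & _ & H1).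
  destruct (Hzw (eps / 2)%R _ ltac:(lra) (compact_mul G _ _ (compact_singleton _ a1) HK))
    as (a2 & A2 & nK & H2).
  exists (tg_mul G (tg_inv G a1) a2). split; [auto|split].
  - intros Kb. apply nK. exists a1, (tg_mul G (tg_inv G a1) a2).
    repeat split; auto. now rewrite tg_mulVKg.
  - rewrite <- (Hiso a1), <- actM, tg_mulVKg.
    pose proof (dtri (act a2 z) w (act a1 z)). rewrite (dsym w) in *. lra.
Qed.

(* If no pair [(c2 x, c1^-1 y)] worked, every [(c1, c2)] in [C * C] would have a
   neighbourhood on which [c1 a c2 x] stays away from [y] for all [a] in [A] outside some
   compact set; compactness makes this uniform over [C * C]. *)
Lemma recurs_cartan (G : TopGroup) (X : Type) (d : X -> X -> R) (act : G -> X -> X)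
    (A C : G -> Prop) (x y : X) :
  is_metric d -> is_action G act -> action_continuous G d act -> isometric_action G d act ->
  tcompact (tg_open G) C ->
  (forall g : G, exists c1 a c2, C c1 /\ A a /\ C c2 /\ g = tg_mul G (tg_mul G c1 a) c2) ->
  recurs G d act (fun _ => True) x y ->
  exists z w, recurs G d act A z w.
Proof.
  intros Hd [act1 actM] Hcont Hiso HC HCAC Hxy. apply NNPP. intros Hno.
  destruct (tg_top G) as (topT & _ & topI & _).
  set (away := fun S1 S2 : G -> Prop => exists (eps : R) (K : G -> Prop),
    (0 < eps)%R /\ tcompact (tg_open G) K /\
    forall c1 a c2, S1 c1 -> A a -> S2 c2 -> ~ K a ->
      (eps <= d (act (tg_mul G (tg_mul G c1 a) c2) x) y)%R).
  assert (away_sub : forall S1 S2 T1 T2 : G -> Prop, (forall g, T1 g -> S1 g) ->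
    (forall g, T2 g -> S2 g) -> away S1 S2 -> away T1 T2).
  { intros S1 S2 T1 T2 I1 I2 (eps & K & He & HK & H). exists eps, K. auto 7. }
  assert (away_union : forall S1 S2 T1 T2 U1 U2 : G -> Prop,
    (forall c1 c2, U1 c1 -> U2 c2 -> (S1 c1 /\ S2 c2) \/ (T1 c1 /\ T2 c2)) ->
    away S1 S2 -> away T1 T2 -> away U1 U2).
  { intros S1 S2 T1 T2 U1 U2 HU (e & K & He & HK & H) (e' & K' & He' & HK' & H').
    exists (Rmin e e'), (fun g => K g \/ K' g).
    split; [now apply Rmin_pos|split; [now apply compact_union|]].
    intros c1 a c2 Hc1 Ha Hc2 nK.
    destruct (HU c1 c2 Hc1 Hc2) as [[]|[]].
    - eapply Rle_trans; [apply Rmin_l|]. apply H; auto.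
    - eapply Rle_trans; [apply Rmin_r|]. apply H'; auto. }
  assert (away_empty : forall S1 S2 : G -> Prop,
    (forall c1 c2, S1 c1 -> S2 c2 -> False) -> away S1 S2).
  { intros S1 S2 H0. exists 1%R, (fun _ => False).
    split; [lra|split; [apply compact_empty|]].
    intros c1 a c2 Hc1 _ Hc2. destruct (H0 c1 c2 Hc1 Hc2). }
  assert (HCC : away C C).
  (* Nested compact inductions over the two factors, as for the product of compact sets. *)
  { apply (compact_ind (tg_open G) C (fun S => away S C) HC).
    - apply away_empty. auto.
    - intros U V. apply away_union. tauto.
    - intros U V UV. apply away_sub; auto.
    - intros c1 Cc1.
      apply (compact_ind (tg_open G) C (fun S => exists U, tg_open G U /\ U c1 /\ away U S) HC).
      + exists (fun _ => True). repeat split; auto.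
      + intros S S' (U & Uo & Uc & HU) (V & Vo & Vc & HV).
        exists (fun g => U g /\ V g). repeat split; auto.
        apply (away_union U S V S'); auto. tauto.
      + intros S S' SS (U & Uo & Uc & HU). exists U. repeat split; auto.
        revert HU. apply away_sub; auto.
      + intros c2 Cc2.
        assert (Hfar : exists eps K, (0 < eps)%R /\ tcompact (tg_open G) K /\
          forall a, A a -> ~ K a -> (eps <= d (act a (act c2 x)) (act (tg_inv G c1) y))%R).
        { apply NNPP. intros H. apply Hno. exists (act c2 x), (act (tg_inv G c1) y).
          intros eps K He HK. apply NNPP. intros H'. apply H. exists eps, K.
          repeat split; auto. intros a Aa Ka. apply Rnot_lt_le. intros Hlt.
          apply H'. exists a. auto. }
        destruct Hfar as (eps & K & He & HK & Hfar).
        (* Moving [c2] and moving [c1] each cost at most a third of [eps], which leaves a third as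
           the uniform gap. *)
        destruct (act_near G X d act c2 x (eps / 3)%R Hd Hcont) as (V & Vo & Vc & HV); [lra|].
        destruct (act_near G X d act c1 (act (tg_inv G c1) y) (eps / 3)%R Hd Hcont)
          as (U & Uo & Uc & HU); [lra|].
        exists V. repeat split; auto. exists U. repeat split; auto.
        exists (eps / 3)%R, K. split; [lra|split; [exact HK|]].
        intros c1' a c2' Uc1 Aa Vc2 Ka. specialize (Hfar a Aa Ka).
        specialize (HV c2' Vc2). specialize (HU c1' Uc1).
        rewrite <- actM, tg_mulgV, act1 in HU.
        rewrite !actM.
        set (w := act (tg_inv G c1) y) in *.
        destruct Hd as (d0 & deq & dsym & dtri).
        pose proof (Hiso a (act c2 x) (act c2' x)).
        pose proof (Hiso c1' (act a (act c2' x)) w).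
        pose proof (dtri (act c1' (act a (act c2' x))) y (act c1' w)).
        pose proof (dtri (act a (act c2 x)) (act a (act c2' x)) w).
        lra. }
  destruct HCC as (eps & K & He & HK & H).
  (* Choosing [g] outside the compact set [C K C] forces its middle factor [a] out of [K]. *)
  destruct (Hxy eps _ He (compact_mul G _ _ (compact_mul G _ _ HC HK) HC))
    as (g & _ & nK & Hg).
  destruct (HCAC g) as (c1 & a & c2 & Cc1 & Aa & Cc2 & Eg).
  assert (Ka : ~ K a).
  { intros Ka. apply nK. exists (tg_mul G c1 a), c2. repeat split; auto.
    exists c1, a. auto. }
  specialize (H c1 a c2 Cc1 Aa Cc2 Ka). rewrite <- Eg in H. lra.
Qed.

(** Recurrence would produce a point [z] whose stabilizer has a closed normal core containing the
    set [Uplus] of a net. As that set is not precompact, the core is not compact, contrary to the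
    hypothesis on fixed points. *)
Lemma not_recurs (G : TopGroup) (X : Type) (d : X -> X -> R) (act : G -> X -> X) :
  qss G -> is_metric d -> is_action G act -> action_continuous G d act ->
  isometric_action G d act ->
  (forall (x : X) (N : G -> Prop),
     normal_subgroup G N -> tclosed (tg_open G) N -> ~ tcompact (tg_open G) N ->
     ~ (forall n, N n -> act n x = x)) ->
  forall x y, ~ recurs G d act (fun _ => True) x y.
Proof.
  intros (_ & A & sA & _ & (C & HC & HCAC) & HA) Hd Hact Hcont Hiso Hnofix x y Hxy.
  destruct (recurs_cartan G X d act A C x y Hd Hact Hcont Hiso HC HCAC Hxy) as (z & w & Hzw).
  apply (recurs_self G X d act A z w Hd Hact Hiso sA) in Hzw.
  destruct (recurs_net G X d act A z z Hzw) as (D & b & Ab & binf & Hb).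
  destruct (HA D b Ab binf) as (E & phi & Hphi & Hnpc & Hdense).
  assert (Hz : forall eps, (0 < eps)%R ->
    exists i0, forall i, dle E i0 i -> (d (act (b (phi i)) z) z < eps)%R).
  { intros eps He. destruct (Hb eps He) as (i0 & Hi0).
    destruct (Hphi i0) as (j0 & Hj0). exists j0. auto. }
  pose proof (not_stabilizer_open G X d act z Hd Hcont) as Scl.
  apply normal_core_closed in Scl.
  apply (Hnofix z (normal_core G (stabilizer G act z))).
  - now apply normal_core_normal, stabilizer_subgroup.
  - exact Scl.
  - intros Ncomp. apply Hnpc. apply (precompact_sub _ _ _ Scl Ncomp).
    exact (core_contains_Uplus G X d act E _ z Hd Hact Hcont Hiso Hz Hdense).
  - intros n Hn. specialize (Hn (tg_one G)). now rewrite conj1g in Hn.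
Qed.

(** * Closed orbits and compact stabilizers *)

(** Compact induction: near each [k], half the distance from [k x] to [y] is a lower bound. *)
Lemma compact_orbit_away (G : TopGroup) (X : Type) (d : X -> X -> R) (act : G -> X -> X)
    (K : G -> Prop) (x y : X) :
  is_metric d -> action_continuous G d act -> tcompact (tg_open G) K ->
  (forall k, K k -> act k x <> y) ->
  exists eps, (0 < eps)%R /\ forall k, K k -> (eps <= d (act k x) y)%R.
Proof.
  intros Hd Hcont HK Hy.
  apply (compact_ind (tg_open G) K
    (fun S => exists eps, (0 < eps)%R /\ forall k, S k -> (eps <= d (act k x) y)%R) HK).
  - exists 1%R. split; [lra|]. intros _ [].
  - intros U V (e & He & HU) (e' & He' & HV). exists (Rmin e e').
    split; [now apply Rmin_pos|]. intros k [Uk|Vk].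
    + eapply Rle_trans; [apply Rmin_l|]; auto.
    + eapply Rle_trans; [apply Rmin_r|]; auto.
  - intros U V UV (e & He & HV). exists e. auto.
  - intros k Kk. specialize (Hy k Kk).
    assert (Hpos : (0 < d (act k x) y)%R).
    { destruct Hd as (d0 & deq & _). destruct (d0 (act k x) y) as [|E]; auto.
      destruct Hy. now apply deq. }
    destruct (act_near G X d act k x (d (act k x) y / 2)%R Hd Hcont)
      as (U & Uo & Uk & HU); [lra|].
    exists U. repeat split; auto. exists (d (act k x) y / 2)%R. split; [lra|].
    intros k' Uk'. specialize (HU k' Uk'). destruct Hd as (_ & _ & _ & dtri).
    pose proof (dtri (act k x) (act k' x) y). lra.
Qed.

Theorem theorem6p1 (G : TopGroup) (X : Type) (d : X -> X -> R)
    (act : G -> X -> X)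
    (HG : qss G)
    (Hd : is_metric d)
    (Hact : is_action G act)
    (Hcont : action_continuous G d act)
    (Hiso : isometric_action G d act)
    (Hnofix : forall (x : X) (Nsub : G -> Prop),
        normal_subgroup G Nsub -> tclosed (tg_open G) Nsub -> ~ tcompact (tg_open G) Nsub ->
        ~ (forall n, Nsub n -> act n x = x)) :
  forall x : X,
    metric_closed d (orbit G act x) /\ tcompact (tg_open G) (stabilizer G act x).
Proof.
  intros x. pose proof (not_recurs G X d act HG Hd Hact Hcont Hiso Hnofix x) as Hno.
  split.
  (* If every ball around [y] meets the orbit, then [x] recurs to [y]: translates by [K] stay at
     distance at least [delta], so any closer orbit point comes from outside [K]. *)
  - intros y Hy. apply NNPP. intros Hfar. apply (Hno y). intros eps K He HK.
    destruct (compact_orbit_away G X d act K x y Hd Hcont HK) as (delta & Hdel & HKd).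
    { intros k _ E. apply Hy. now exists k. }
    apply NNPP. intros Hg. apply Hfar. exists (Rmin eps delta).
    split; [now apply Rmin_pos|]. intros t Ht [g <-].
    destruct Hd as (_ & _ & dsym & _). rewrite dsym in Ht.
    apply Hg. exists g. split; [exact I|split].
    + intros Kg. specialize (HKd g Kg). pose proof (Rmin_r eps delta). lra.
    + pose proof (Rmin_l eps delta). lra.
  (* The stabilizer is closed, so if it is not compact it lies in no compact [K]. Its elements
     outside each [K] make [x] recur to itself. *)
  - apply NNPP. intros Hnc. apply (Hno x). intros eps K He HK.
    apply NNPP. intros Hg. apply Hnc.
    apply (compact_closed_sub (tg_open G) K); [exact HK| |].
    + intros g Sg. apply NNPP. intros nK. apply Hg. exists g.
      split; [exact I|split; [exact nK|]]. rewrite Sg.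
      destruct Hd as (_ & deq & _). now rewrite (proj2 (deq x x) eq_refl).
    + intros g Sg. exists (fun g => ~ stabilizer G act x g).
      split; [exact (not_stabilizer_open G X d act x Hd Hcont)|auto].
Qed.
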